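(* For any permutation $\pi \in \mathfrak{S}_n$ and any $D \subseteq [n - 1]$, the value $\operatorname{ls}_D(\pi)$ depends only on the recording tableau $Q(\pi)$; that is, if $\pi,\sigma\in\mathfrak{S}_n$ satisfy $Q(\pi)=Q(\sigma)$, then $\operatorname{ls}_D(\pi)=\operatorname{ls}_D(\sigma)$ for every $D\subseteq[n-1]$.
   Context: $\mathfrak{S}_n$ is the set of permutations of $[n]=\{1,\dots,n\}$. $Q(\pi)$ is the recording tableau of $\pi$ under the Robinson–Schensted correspondence (row insertion of $\pi(1),\dots,\pi(n)$ in order). For $I=\{i_1<\cdots<i_k\}\subseteq[n]$, $\pi_I=\pi(i_1)\cdots\pi(i_k)$; the descent set of a sequence $\sigma$ of length $m$ is $\operatorname{Des}(\sigma)=\{i\in[m-1] : \sigma(i)>\sigma(i+1)\}$. $\operatorname{ls}_D(\pi)=\max\{\#I : I\subseteq[n],\ \operatorname{Des}(\pi_I)=D\}$ (equal to $0$ if there is no such $I$). *)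

(* Defs.v *)
From mathcomp Require Import all_boot perm finmap.

Set Implicit Arguments.
Unset Strict Implicit.
Unset Printing Implicit Defensive.

(* All positions and values are numbered from 1: since ['I_n] is
   {0, ..., n-1}, the ordinal [i] stands for the element [i.+1] of [n]. *)

(* [enum I] lists [I] in increasing order. *)
Definition subword (n : nat) (pi : 'S_n) (I : {set 'I_n}) : seq nat :=
  [seq (pi i).+1 | i <- enum I].

Definition word (n : nat) (pi : 'S_n) : seq nat := subword pi [set: 'I_n].

(* The set {1, ..., m}. *)
Definition interval1 (m : nat) : {fset nat} := [fset i in iota 1 m]%fset.

(* [nth 0 w i.-1] is the i-th letter of [w], counted from 1. *)
Definition Des (w : seq nat) : {fset nat} :=
  [fset i in interval1 (size w).-1 | nth 0 w i.-1 > nth 0 w i]%fset.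

(* The maximum over an empty family is 0. *)
Definition ls (n : nat) (D : {fset nat}) (pi : 'S_n) : nat :=
  \max_(I : {set 'I_n} | Des (subword pi I) == D) #|I|.

(* Tableaux are given by their rows, longest row first. *)
Definition tableau := seq (seq nat).

(* Row insertion of [x]: in the top row, [x] replaces the leftmost entry
   greater than [x], which is then inserted into the remaining rows; if there
   is no such entry, [x] is appended to the row.  The second component is the
   index, from 0, of the row where the new cell appears. *)
Fixpoint row_insert (x : nat) (P : tableau) : tableau * nat :=
  if P is r :: P' then
    let j := find (fun y => x < y) r in
    if j < size r then
      let: (P'', i) := row_insert (nth 0 r j) P' in
      (set_nth 0 r j x :: P'', i.+1)
    else (rcons r x :: P', 0)
  else ([:: [:: x]], 0).

Definition add_cell (Q : tableau) (i k : nat) : tableau :=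
  set_nth [::] Q i (rcons (nth [::] Q i) k).

(* One step of the correspondence on (insertion, recording) tableaux, for the
   letter [xk.1] at position [xk.2]. *)
Definition RS_step (PQ : tableau * tableau) (xk : nat * nat) :
    tableau * tableau :=
  let: (P, i) := row_insert xk.1 PQ.1 in (P, add_cell PQ.2 i xk.2).

Definition RS (w : seq nat) : tableau * tableau :=
  foldl RS_step ([::], [::]) (zip w (iota 1 (size w))).

Definition recording_tableau (n : nat) (pi : 'S_n) : tableau := (RS (word pi)).2.

(* Main.v *)
Require Import Defs.
From mathcomp Require Import all_boot perm finmap zify.

Set Implicit Arguments.
Unset Strict Implicit.
Unset Printing Implicit Defensive.

(** The recording tableau of pi is the insertion tableau of the inverse of pi,
    so equal recording tableaux mean Knuth equivalent inverses, and a Knuth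
    move on the inverse can be compensated inside any chosen subsequence.

    A set I of positions of pi, listed increasingly, is a set S of letters of
    the word u of the inverse of pi: the letter s occurs in u at index pi(s).
    Hence the descents of pi_I are the pairs of consecutive elements s < t of
    S such that t precedes s in u ([inv_Des]), and ls_D(pi) is the largest
    size of a set S of letters of u with that pattern equal to D.

    - Symmetry ([recording_tableau_inverse]).  Inserting a largest letter M at
      label j into the middle of a word changes the recording tableau by one
      row insertion of j ([RS_insert_max]).  Both tableaux of the pair follow
      the same law: a cell that carries a maximal entry, added before a row
      insertion, survives it unless the insertion ends in that very row, and
      then it is pushed one row down ([row_insert_add_cell]).  Adding the
      values of pi one by one in increasing order yields the insertion tableau
      of the inverse.

    - Knuth's theorem ([knuth_insertion_tableau]).  A word is Knuth equivalent
      to the reading word of its insertion tableau, since a bump in one row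
      is a succession of Knuth moves ([knuth_bump]).

    - Exchange ([inv_Des_sub_block]).  A Knuth move permutes a block of three
      letters x < y < z and only reverses the order of x and z.  This affects
      the pattern of S only when x and z are consecutive in S, so that y is
      not in S.  Replacing z, or else x, by y then restores the pattern: y takes
      the same place in S because no element of S lies between x and z, and
      the block is contiguous, so y precedes or follows every letter outside
      the block just as x and z do. *)

(** * Row insertion *)

Lemma row_insert_append x r P :
  all (fun y => y <= x) r -> row_insert x (r :: P) = (rcons r x :: P, 0).
Proof.
move=> r_le /=; rewrite hasNfind ?ltnn // -all_predC.
by apply: sub_all r_le => y /=; rewrite -leqNgt.
Qed.

Lemma row_insert_bump x y a b P :
  all (fun y => y <= x) a -> x < y ->
  row_insert x ((a ++ y :: b) :: P)
  = ((a ++ x :: b) :: (row_insert y P).1, (row_insert y P).2.+1).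
Proof.
move=> a_le xy /=.
have -> : find (fun y => x < y) (a ++ y :: b) = size a.
  rewrite find_cat ifN /= ?xy ?addn0 // -all_predC.
  by apply: sub_all a_le => z /=; rewrite -leqNgt.
rewrite size_cat /= addnS ltnS leq_addr.
rewrite nth_cat ltnn subnn /=; case: row_insert => P' i /=.
suff -> : set_nth 0 (a ++ y :: b) (size a) x = a ++ x :: b by [].
by elim: a {a_le} => //= z a ->.
Qed.

Lemma row_split x r :
  all (fun y => y <= x) r \/
  exists a y b, [/\ r = a ++ y :: b, all (fun y => y <= x) a & x < y].
Proof.
have [|r_gt] := boolP (all (fun y => y <= x) r); [by left | right].
elim: r r_gt => //= y r IHr; case: leqP => [yx /= | xy _]; last first.
  by exists [::], y, r.
move=> /IHr [a [z [b [-> a_le xz]]]]; exists (y :: a), z, b.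
by split=> //=; rewrite yx.
Qed.

Lemma row_insert_index x P : (row_insert x P).2 <= size P.
Proof.
elim: P x => [|r P IHP] x //.
have [r_le|[a [y [b [-> a_le xy]]]]] := row_split x r.
  by rewrite row_insert_append.
by rewrite row_insert_bump //= ltnS.
Qed.

Lemma size_row_insert x P :
  size (row_insert x P).1 = maxn (row_insert x P).2.+1 (size P).
Proof.
elim: P x => [|r P IHP] x //.
have [r_le|[a [y [b [-> a_le xy]]]]] := row_split x r.
  by rewrite row_insert_append //= maxnSS max0n.
by rewrite row_insert_bump //= IHP maxnSS.
Qed.

Lemma all_row_insert (p : pred nat) x P :
  p x -> all (all p) P -> all (all p) (row_insert x P).1.
Proof.
elim: P x => [|r P IHP] x px; first by rewrite /= px.
have [r_le|[a [y [b [-> a_le xy]]]]] := row_split x r.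
  by rewrite row_insert_append //= all_rcons px.
rewrite row_insert_bump //= !all_cat /=.
by case/andP=> /and3P[-> py ->] allP; rewrite px IHP.
Qed.

Lemma size_add_cell Q i k : size (add_cell Q i k) = maxn i.+1 (size Q).
Proof. exact: size_set_nth. Qed.

Lemma all_add_cell (p : pred nat) Q i k :
  p k -> all (all p) Q -> all (all p) (add_cell Q i k).
Proof.
move=> pk; rewrite /add_cell.
elim: Q i => [|r Q IHQ] [|i] //=.
- by rewrite pk.
- by move=> _; elim: i => [|i IHi] /=; rewrite ?pk ?nth_nil.
- by case/andP=> pr pQ; rewrite all_rcons pk pr.
- by case/andP=> -> /IHQ; apply.
Qed.

Lemma row_insert_max x P :
  all (all (fun y => y < x)) P -> row_insert x P = (add_cell P 0 x, 0).
Proof.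
case: P => [//|r P] /andP[r_lt _].
by rewrite row_insert_append //; apply: sub_all r_lt => y /ltnW.
Qed.

(** The new cell of [row_insert x P] and a maximal entry [M] placed at the end
    of row [r] interact only when both claim the same row: the path of [x]
    ends by bumping [M], which moves to the end of the next row.  The lemma
    serves twice in the symmetry argument: for the letters, with [M] the
    largest letter, and for the labels, with [M] the latest label. *)
Lemma row_insert_add_cell x M P r :
  x < M -> all (all (fun y => y < M)) P -> r <= size P ->
  let: (P1, s) := row_insert x P in
  row_insert x (add_cell P r M)
  = if s == r then (add_cell P1 r.+1 M, r.+1) else (add_cell P1 r M, s).
Proof.
elim: P x r => [|row P IHP] x r xM.
  by case: r => //= _ _; rewrite xM.
case/andP=> row_lt P_lt.
have [r_le|[a [y [b [Erow a_le xy]]]]] := row_split x row.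
  rewrite row_insert_append //; case: r => [|r] le_r /=; last first.
    by have /= -> := row_insert_append (add_cell P r M) r_le.
  rewrite -cats1; have /= -> := row_insert_bump [::] P r_le xM.
  by rewrite row_insert_max //= cats1.
have yM : y < M by apply: (allP row_lt); rewrite Erow mem_cat mem_head orbT.
rewrite Erow row_insert_bump //; case: r => [|r] le_r.
  rewrite /add_cell /= rcons_cat rcons_cons.
  by have /= -> := row_insert_bump (rcons b M) P a_le xy; rewrite rcons_cat.
have /= -> := row_insert_bump b (add_cell P r M) a_le xy.
have := IHP y r yM P_lt le_r; case: row_insert => P1 s ->.
by rewrite eqSS; case: eqP.
Qed.

(** * The recording tableau is the insertion tableau of the inverse *)

Definition insertion_tableau (u : seq nat) : tableau :=
  foldl (fun P x => (row_insert x P).1) [::] u.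

Lemma insertion_tableau_rcons u x :
  insertion_tableau (rcons u x) = (row_insert x (insertion_tableau u)).1.
Proof. exact: foldl_rcons. Qed.

Lemma RS_state W m c :
  all (fun xk => xk.1 < m) W -> all (fun xk => xk.2 < c) W ->
  let: (P, Q) := foldl RS_step ([::], [::]) W in
  [/\ size P = size Q, all (all (fun y => y < m)) P
    & all (all (fun y => y < c)) Q].
Proof.
elim/last_ind: W => [//|W [x k] IHW].
rewrite !all_rcons foldl_rcons => /andP[/= xm /IHW {}IHW] /andP[/= kc /IHW].
case: foldl => P Q [PQ Pm Qc]; rewrite /RS_step /=.
have := all_row_insert (p := fun y => y < m) xm Pm; have := size_row_insert x P.
case: row_insert => P1 s /= -> P1m; split=> //; last exact: all_add_cell.
by rewrite size_add_cell PQ.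
Qed.

(** The letters of [B] keep the two computations, with and without [(M, j)],
    in a fixed relation: the insertion tableaux differ by a cell [M] in row
    [r], the recording tableaux by the row insertion of [j], and [r] is the row
    where that insertion creates its cell.  When a letter of [B] ends in row
    [r], it pushes [M] down in the first tableau, while in the second its label
    sits at the end of row [r] and is bumped by the insertion of [j]; either
    way the two cells in question end up in rows [r] and [r.+1]. *)
Lemma RS_insert_max A B M j :
  all (fun xk => xk.1 < M) (A ++ B) -> all (fun xk => xk.2 < j) A ->
  sorted ltn (j :: unzip2 B) ->
  (foldl RS_step ([::], [::]) (A ++ (M, j) :: B)).2
  = (row_insert j (foldl RS_step ([::], [::]) (A ++ B)).2).1.
Proof.
move=> AB_M A_j B_j.
suff: let: (P', Q') := foldl RS_step ([::], [::]) (A ++ B) in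
      let: (Q, r) := row_insert j Q' in
      foldl RS_step ([::], [::]) (A ++ (M, j) :: B) = (add_cell P' r M, Q).
  by case: (foldl RS_step _ (A ++ B)) => P' Q'; case: row_insert => Q r ->.
elim/last_ind: B AB_M B_j => [|B [x k] IHB].
  rewrite cats0 cats1 foldl_rcons => /RS_state - /(_ j A_j) + _.
  case: foldl => P Q [_ PM Qj].
  by rewrite /RS_step /= !row_insert_max.
rewrite -rcons_cons -!rcons_cat !foldl_rcons all_rcons => /andP[xM AB_M].
rewrite /unzip2 map_rcons -rcons_cons (@sorted_pairwise _ ltn ltn_trans).
rewrite pairwise_rcons -(@sorted_pairwise _ ltn ltn_trans) => /andP[jB_k B_j].
move: jB_k; rewrite /= all_map => /andP[/= jk B_k].
have AB_k : all (fun xk => xk.2 < k) (A ++ B).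
  rewrite all_cat; apply/andP; split=> //.
  by apply: sub_all A_j => xk /ltn_trans; apply.
have {IHB} := IHB AB_M B_j; have := RS_state AB_M AB_k.
case: (foldl RS_step _ (A ++ B)) xM => P' Q' /= xM [PQ PM Qk].
have := row_insert_add_cell jk Qk; have := row_insert_index j Q'.
case: (row_insert j Q') => Q1 r /= r_le /(_ (row_insert x P').2).
rewrite -PQ row_insert_index => /(_ isT) insQ ->; rewrite /RS_step /=.
have := row_insert_add_cell xM PM (r := r); rewrite PQ => /(_ r_le).
move: insQ; case: (row_insert x P') => P1 s /= -> ->.
by rewrite [r == s]eq_sym; case: eqP => // ->.
Qed.

Definition inverse_word n (pi : 'S_n) : seq nat :=
  [seq ((pi^-1)%g v).+1 | v <- enum 'I_n].

Lemma recording_tableau_inverse n (pi : 'S_n) :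
  recording_tableau pi = insertion_tableau (inverse_word pi).
Proof.
(* [W k] is the biword of [pi] restricted to its [k] smallest values; passing
   from [k] to [k.+1] inserts a largest letter, at the position that is the
   next letter of the inverse. *)
pose W k := [seq ((pi i).+1, i.+1) | i <- enum 'I_n & pi i < k].
have WE : zip (word pi) (iota 1 (size (word pi))) = W n.
  rewrite /W (eq_filter (a2 := predT)) ?filter_predT => [|i]; last first.
    exact: ltn_ord.
  have -> : iota 1 (size (word pi)) = [seq i.+1 | i : 'I_n <- enum 'I_n].
    rewrite size_map -cardE cardsT card_ord -[1]addn0 iotaDl.
    by rewrite -val_enum_ord -map_comp.
  rewrite /word /subword (eq_enum (in_set _)).
  by elim: (enum 'I_n) => //= i s ->.
suff QW k : k <= n ->
    (foldl RS_step ([::], [::]) (W k)).2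
    = insertion_tableau (take k (inverse_word pi)).
  rewrite /recording_tableau /RS WE QW //.
  by rewrite take_oversize // size_map size_enum_ord.
elim: k => [|k IHk] kn.
  by rewrite take0 /W (eq_filter (a2 := pred0)) ?filter_pred0.
pose i0 := (pi^-1)%g (Ordinal kn).
have pi_i0 : pi i0 = Ordinal kn by rewrite permKV.
have -> : take k.+1 (inverse_word pi) = rcons (take k (inverse_word pi)) i0.+1.
  rewrite (take_nth 0); last by rewrite size_map size_enum_ord.
  rewrite (nth_map (Ordinal kn)) ?size_enum_ord //.
  by rewrite (nth_ord_enum (Ordinal kn) (Ordinal kn)).
rewrite insertion_tableau_rcons.
rewrite -IHk ?(ltnW kn) // /W.
have i0_enum : i0 \in enum 'I_n by rewrite mem_enum.
have := enum_uniq 'I_n; have: sorted ltn [seq val i | i <- enum 'I_n].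
  by rewrite val_enum_ord iota_ltn_sorted.
have ltk1 i : i != i0 -> (pi i < k.+1) = (pi i < k).
  move=> i_i0; rewrite ltnS leq_eqVlt; case: eqP => // Ek.
  by case/eqP: i_i0; apply: (@perm_inj _ pi); rewrite pi_i0; apply: val_inj.
case/splitPr: i0_enum => e1 e2; rewrite cat_uniq /= => e_sorted.
case/and3P=> _ /norP[i0_e1 _] /andP[i0_e2 _].
have filt e : i0 \notin e ->
    [seq i : 'I_n <- e | pi i < k.+1] = [seq i : 'I_n <- e | pi i < k].
  move=> i0_e; apply: eq_in_filter => i ie; apply: ltk1.
  by apply: contraNneq i0_e => <-.
rewrite !filter_cat /= !filt // pi_i0 /= ltnSn ltnn !map_cat /= pi_i0 /=.
move: e_sorted; rewrite (@sorted_pairwise _ ltn ltn_trans) pairwise_map.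
rewrite pairwise_cat pairwise_cons.
case/and3P=> /allrelP e1_lt _ /andP[/allP e2_gt e2_sorted].
apply: RS_insert_max.
- rewrite -map_cat all_map -filter_cat all_filter.
  by apply/allP => i _; apply/implyP.
- rewrite all_map all_filter; apply/allP => i ie1; apply/implyP => _.
  by rewrite /= ltnS; apply: e1_lt => //; apply: mem_head.
- rewrite /unzip2 -map_comp (@sorted_pairwise _ ltn ltn_trans).
  rewrite pairwise_cons all_map all_filter pairwise_map pairwise_filter ?andbT //.
  by apply/allP => i ie2; apply/implyP => _; apply: (e2_gt i).
Qed.

(** * Knuth equivalence and insertion tableaux *)

(** The weak inequalities are the moves for words with repeated letters; with
    them the reading word argument needs only that rows are weakly increasing,
    and distinctness of letters enters only for [inv_Des_sub]. *)
Inductive knuth : seq nat -> seq nat -> Prop :=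
| knuth_refl u : knuth u u
| knuth_sym u v : knuth u v -> knuth v u
| knuth_trans v u w : knuth u v -> knuth v w -> knuth u w
| knuth_xzy a b x y z : x <= y < z ->
    knuth (a ++ [:: x; z; y] ++ b) (a ++ [:: z; x; y] ++ b)
| knuth_yzx a b x y z : x < y <= z ->
    knuth (a ++ [:: y; z; x] ++ b) (a ++ [:: y; x; z] ++ b).

Lemma knuth_cat c d u v : knuth u v -> knuth (c ++ u ++ d) (c ++ v ++ d).
Proof.
elim=> {u v} [u|u v _|v u w _ IHu _|a b x y z H|a b x y z H].
- exact: knuth_refl.
- exact: knuth_sym.
- exact: knuth_trans.
- by rewrite -!catA !(catA c); apply: knuth_xzy.
- by rewrite -!catA !(catA c); apply: knuth_yzx.
Qed.

(** First [x] travels left through [b], by moves p z x = p x z whose pivot p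
    is the letter before the exchanged pair; then [y] travels left through [a],
    by moves w y p = y w p whose pivot is the letter after it. *)
Lemma knuth_bump a b x y :
  sorted leq (a ++ y :: b) -> all (fun y => y <= x) a -> x < y ->
  knuth (rcons (a ++ y :: b) x) (y :: a ++ x :: b).
Proof.
move=> r_sorted a_le xy.
have {r_sorted} [a_sorted yb_sorted] : sorted leq a /\ sorted leq (y :: b).
  move: r_sorted; rewrite !(@sorted_pairwise nat leq leq_trans).
  by rewrite pairwise_cat => /and3P[_ -> ->].
apply: (@knuth_trans (a ++ y :: x :: b)).
  rewrite rcons_cat rcons_cons.
  suff H : knuth (y :: rcons b x) (y :: x :: b).
    by have := knuth_cat a [::] H; rewrite !cats0.
  elim/last_ind: b yb_sorted => [|b z IHb]; first by move=> _; apply: knuth_refl.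
  rewrite /= rcons_path => /andP[yb bz].
  apply: (@knuth_trans (rcons (y :: rcons b x) z)); last first.
    by have := knuth_cat [::] [:: z] (IHb yb); rewrite !cats1 /=.
  have ylast : y <= last y b.
    move: yb; rewrite (path_sortedE leq_trans) => /andP[/allP yb _].
    by have := mem_last y b; rewrite inE => /predU1P[->|/yb].
  have E c : y :: rcons (rcons b c) x = belast y b ++ [:: last y b; c; x].
    by rewrite -!rcons_cons (lastI y b) -!cats1 -!catA.
  have -> : rcons (y :: rcons b x) z = belast y b ++ [:: last y b; x; z].
    by rewrite -!rcons_cons (lastI y b) -!cats1 -!catA.
  rewrite E; have := @knuth_yzx (belast y b) [::] x (last y b) z.
  by rewrite !cats0; apply; rewrite (leq_trans xy ylast).
elim/last_ind: a x xy a_le b {yb_sorted} a_sorted => [|a w IHa] x xy.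
  by move=> *; apply: knuth_refl.
rewrite all_rcons => /andP[wx a_le] b aw_sorted.
apply: (@knuth_trans (a ++ y :: w :: x :: b)).
  by rewrite cat_rcons; apply: (@knuth_xzy a b w x y); rewrite wx.
rewrite cat_rcons; apply: IHa; first exact: leq_ltn_trans xy.
  move: aw_sorted; rewrite (@sorted_pairwise nat leq leq_trans) -cats1 pairwise_cat.
  case/andP=> /allrelP aw _; apply/allP => c ca; apply: aw => //; exact: mem_head.
by move: aw_sorted; rewrite -cats1 => /cat_sorted2 [].
Qed.

(** Rows are read from the last to the first, so that a letter bumped out of
    the first row stands next to the word of the rows below, where it is to be
    inserted. *)
Definition reading (P : tableau) : seq nat := flatten (rev P).

Lemma reading_cons r P : reading (r :: P) = reading P ++ r.
Proof. by rewrite /reading rev_cons flatten_rcons. Qed.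

Lemma knuth_row_insert x P : all (sorted leq) P ->
  all (sorted leq) (row_insert x P).1 /\
  knuth (rcons (reading P) x) (reading (row_insert x P).1).
Proof.
elim: P x => [|r P IHP] x; first by split=> //; apply: knuth_refl.
move=> /= /andP[r_sorted P_sorted].
have [r_le|[a [y [b [Er a_le xy]]]]] := row_split x r.
  have /= -> := row_insert_append P r_le.
  rewrite /= P_sorted !reading_cons rcons_cat andbT; split; last exact: knuth_refl.
  rewrite (@sorted_pairwise nat leq leq_trans) -cats1 pairwise_cat /= andbT.
  by rewrite -(@sorted_pairwise nat leq leq_trans) r_sorted allrel1r r_le.
move: r_sorted; rewrite Er => r_sorted.
have [P1_sorted P1_knuth] := IHP y P_sorted.
have /= -> := row_insert_bump b P a_le xy; rewrite /= P1_sorted andbT; split.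
  move: r_sorted; rewrite !(@sorted_pairwise nat leq leq_trans) !pairwise_cat /=.
  case/and4P=> /allrelP ayb -> /allP yb ->; rewrite !andbT /=; apply/andP; split.
    apply/allrelP => c d ca; rewrite inE => /predU1P[->|db].
      by move/allP: a_le; apply.
    by apply: ayb => //; rewrite inE db orbT.
  by apply/allP => d /yb; apply: leq_trans; apply: ltnW.
rewrite !reading_cons rcons_cat.
have := knuth_cat (reading P) [::] (knuth_bump r_sorted a_le xy).
rewrite !cats0 => /knuth_trans; apply.
by have := knuth_cat [::] (a ++ x :: b) P1_knuth; rewrite /= cat_rcons.
Qed.

Lemma knuth_insertion_tableau u : knuth u (reading (insertion_tableau u)).
Proof.
suff [] : all (sorted leq) (insertion_tableau u) /\
  knuth u (reading (insertion_tableau u)) by [].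
elim/last_ind: u => [|u x [IHs IHu]]; first by split=> //; apply: knuth_refl.
rewrite insertion_tableau_rcons.
have [s_x u_x] := knuth_row_insert x IHs; split=> //.
apply: knuth_trans u_x.
by have := knuth_cat [::] [:: x] IHu; rewrite !cats1.
Qed.

(** * Knuth moves and descents of subsequences of the inverse *)

Lemma eq_Des w w' : size w = size w' ->
  (forall i, i.+1 < size w ->
     (nth 0 w i.+1 < nth 0 w i) = (nth 0 w' i.+1 < nth 0 w' i)) ->
  Des w = Des w'.
Proof.
move=> eq_size eq_lt; apply/fsetP => i; rewrite /Des /interval1 !inE /= eq_size.
case: i => [|i]; rewrite !mem_iota //= -eq_size.
by case: ltnP => //= lt_i; apply: eq_lt; lia.
Qed.

(** If [u] lists the positions of a permutation by increasing value, and [S]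
    lists a set of positions in increasing order, this is the descent set of
    the subsequence at [S]. *)
Definition inv_Des (u S : seq nat) := Des [seq index s u | s <- S].

Lemma eq_inv_Des u v (f : nat -> nat) S :
  (forall i, i.+1 < size S ->
     let s := nth 0 S i in let t := nth 0 S i.+1 in
     (index t u < index s u) = (index (f t) v < index (f s) v)) ->
  inv_Des u S = inv_Des v (map f S).
Proof.
move=> eq_lt; apply: eq_Des; rewrite !size_map // => i lt_i.
by rewrite -map_comp !(nth_map 0) //; [apply: eq_lt | apply: ltnW..].
Qed.

(** The weak form of equality of all ls_D on the level of inverses: a set of
    letters of [u] has a counterpart in [v] of the same size and pattern. *)
Definition inv_Des_sub (u v : seq nat) : Prop :=
  forall S, sorted ltn S -> {subset S <= u} ->
  exists S', [/\ sorted ltn S', {subset S' <= v}, size S' = size S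
               & inv_Des v S' = inv_Des u S].

(** Contiguity of the block: two letters of [c] compare in the same way with
    any letter outside [c], so a letter of the block may be replaced by another
    one as long as the comparisons within the block agree. *)
Lemma index_block_lt (a b c c' : seq nat) s t s' t' :
  uniq (a ++ c ++ b) -> perm_eq c c' ->
  (if s \in c then s' \in c else s' == s) ->
  (if t \in c then t' \in c else t' == t) ->
  (s \in c -> t \in c -> (index t c < index s c) = (index t' c' < index s' c')) ->
  (index t (a ++ c ++ b) < index s (a ++ c ++ b))
  = (index t' (a ++ c' ++ b) < index s' (a ++ c' ++ b)).
Proof.
rewrite cat_uniq => /and3P[_ /hasPn ac _] cc' ss' tt' eq_lt.
have mem_cc' := perm_mem cc'.
have size_cc' := perm_size cc'.
have index_in e r : perm_eq c e -> r \in c ->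
    index r (a ++ e ++ b) = size a + index r e /\ index r e < size c.
  move=> ce rc; have re : r \in e by rewrite -(perm_mem ce).
  rewrite index_cat ifN; last by apply: ac; rewrite mem_cat rc.
  by rewrite index_cat re (perm_size ce) index_mem.
have index_out r : r \notin c ->
    index r (a ++ c ++ b) = index r (a ++ c' ++ b) /\
    (index r (a ++ c ++ b) < size a \/ size a + size c <= index r (a ++ c ++ b)).
  move=> rc; rewrite !index_cat -mem_cc' (negPf rc) -size_cc'.
  case: ifP => ra; split=> //; first by left; rewrite index_mem.
  by right; rewrite addnA leq_addr.
have [sc|sc] := boolP (s \in c); rewrite ?sc ?(negPf sc) in ss' eq_lt;
have [tc|tc] := boolP (t \in c); rewrite ?tc ?(negPf tc) in tt' eq_lt.
- have [-> _] := index_in c s (perm_refl _) sc.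
  have [-> _] := index_in c t (perm_refl _) tc.
  have [-> _] := index_in c' s' cc' ss'; have [-> _] := index_in c' t' cc' tt'.
  by rewrite !ltn_add2l eq_lt.
- move/eqP: tt' => ->; have [<- ?] := index_out t tc.
  by have [-> ?] := index_in c s (perm_refl _) sc;
     have [-> ?] := index_in c' s' cc' ss'; lia.
- move/eqP: ss' => ->; have [<- ?] := index_out s sc.
  by have [-> ?] := index_in c t (perm_refl _) tc;
     have [-> ?] := index_in c' t' cc' tt'; lia.
- move/eqP: tt' => ->; move/eqP: ss' => ->.
  by have [<- _] := index_out t tc; have [<- _] := index_out s sc.
Qed.

Lemma sorted_consecutive S i r : sorted ltn S -> i.+1 < size S -> r \in S ->
  (r <= nth 0 S i) || (nth 0 S i.+1 <= r).
Proof.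
move=> S_sorted lt_i rS.
have S_leq : sorted leq S by apply: sub_sorted S_sorted => s t; apply: ltnW.
have nth_leq := sorted_leq_nth leq_trans leqnn 0 S_leq.
rewrite -(nth_index 0 rS); have lt_r : index r S < size S by rewrite index_mem.
case: (leqP (index r S) i) => le_i.
  by rewrite nth_leq ?inE // ltnW.
by rewrite orbC nth_leq.
Qed.

(** The exchange argument.  The hypotheses on [c] and [c'] are symmetric enough
    to cover both Knuth moves in both directions: the pairs (x, y) and (y, z)
    keep their order, and the old order of (x, z) reappears in one of the pairs
    (x, y), (y, z) of the new block.  This says which of x and z gives way to y
    when both are consecutive in [S]; otherwise [S] itself will do. *)
Lemma inv_Des_sub_block a b c c' x y z :
  x < y < z -> uniq (a ++ c ++ b) ->
  perm_eq c [:: x; y; z] -> perm_eq c' [:: x; y; z] ->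
  (index y c < index x c) = (index y c' < index x c') ->
  (index z c < index y c) = (index z c' < index y c') ->
  (index z c < index x c) = (index y c' < index x c') \/
  (index z c < index x c) = (index z c' < index y c') ->
  inv_Des_sub (a ++ c ++ b) (a ++ c' ++ b).
Proof.
move=> /andP[xy yz] u_uniq c_xyz c'_xyz eq_xy eq_yz eq_xz S S_sorted S_sub.
have cc' : perm_eq c c' by rewrite (perm_trans c_xyz) // perm_sym.
have mem_c r : (r \in c) = [|| r == x, r == y | r == z].
  by rewrite (perm_mem c_xyz) !inE.
have mem_uv r : (r \in a ++ c ++ b) = (r \in a ++ c' ++ b).
  by rewrite !mem_cat (perm_mem cc').
(* [gap] says that x and z are consecutive elements of S. *)
pose gap := [&& x \in S, z \in S & all (fun r => (r <= x) || (z <= r)) S].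
suff [f [f_lt f_c f_out f_des]] : exists f : nat -> nat,
    [/\ {in S &, {homo f : s t / s < t}}, {in c, forall s, f s \in c},
        forall s, s \notin c -> f s = s
      & forall i, i.+1 < size S ->
        let s := nth 0 S i in let t := nth 0 S i.+1 in
        s \in c -> t \in c ->
        (index t c < index s c) = (index (f t) c' < index (f s) c')].
  exists (map f S); split.
  - by move: (homo_sorted_in f_lt (allss S) S_sorted).
  - move=> _ /mapP[s sS ->]; rewrite -mem_uv.
    have [sc|/f_out ->] := boolP (s \in c); last exact: S_sub.
    by rewrite !mem_cat f_c // orbT.
  - exact: size_map.
  - symmetry; apply: eq_inv_Des => i lt_i s t; apply: index_block_lt => //.
    + by case: ifPn => [/f_c|/f_out ->].
    + by case: ifPn => [/f_c|/f_out ->].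
    + exact: f_des.
have nth_S i : i.+1 < size S ->
    [/\ nth 0 S i \in S, nth 0 S i.+1 \in S & nth 0 S i < nth 0 S i.+1].
  move=> lt_i; rewrite !mem_nth ?(ltnW lt_i) //; split=> //.
  by apply: (sortedP 0 S_sorted).
have [/and3P[xS zS /allP S_gap]|no_gap] := boolP gap; last first.
  exists id; split=> // i lt_i s t.
  have [sS tS st] := nth_S i lt_i; rewrite !mem_c -/s -/t in sS tS st *.
  have not_xz : ~~ ((s == x) && (t == z)).
    apply: contra no_gap => /andP[/eqP sx /eqP tz].
    rewrite /gap -sx -tz sS tS; apply/allP => r; exact: sorted_consecutive.
  case/or3P=> /eqP sE /or3P[] /eqP tE; move: st not_xz;
    rewrite sE tE ?eqxx ?ltnn // => ts; exfalso; clear -xy yz ts; lia.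
have c_S s : s \in c -> s \in S -> (s == x) || (s == z).
  rewrite mem_c => /or3P[] /eqP->; rewrite ?eqxx ?orbT // => /S_gap/orP[].
    by rewrite leqNgt xy.
  by rewrite leqNgt yz.
have xz_c i : i.+1 < size S -> nth 0 S i \in c -> nth 0 S i.+1 \in c ->
    nth 0 S i = x /\ nth 0 S i.+1 = z.
  move=> /nth_S[sS tS st] /c_S - /(_ sS) + /c_S - /(_ tS).
  by clear -xy yz st; lia.
case: eq_xz => eq_xz.
- exists (fun s => if s == z then y else s); split.
  + move=> s t /S_gap + /S_gap; clear -xy yz; case: eqP; case: eqP => /=; lia.
  + by move=> s sc; case: eqP => // _; rewrite mem_c eqxx orbT.
  + by move=> s; rewrite mem_c !negb_or => /and3P[_ _ /negPf ->].
  + move=> i lt_i /= sc tc; have [-> ->] := xz_c i lt_i sc tc.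
    by rewrite eqxx ltn_eqF // (ltn_trans xy).
- exists (fun s => if s == x then y else s); split.
  + move=> s t /S_gap + /S_gap; clear -xy yz; case: eqP; case: eqP => /=; lia.
  + by move=> s sc; case: eqP => // _; rewrite mem_c eqxx orbT.
  + by move=> s; rewrite mem_c !negb_or => /and3P[/negPf ->].
  + move=> i lt_i /= sc tc; have [-> ->] := xz_c i lt_i sc tc.
    by rewrite eqxx gtn_eqF // (ltn_trans xy).
Qed.

Lemma knuth_perm u v : knuth u v -> perm_eq u v.
Proof.
elim=> {u v} [u|u v _|v u w _ uv _ vw|a b x y z _|a b x y z _] //.
- by rewrite perm_sym.
- exact: perm_trans vw.
- by rewrite perm_cat2l perm_cat2r; apply/seq.permP => p /=; lia.
- by rewrite perm_cat2l perm_cat2r; apply/seq.permP => p /=; lia.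
Qed.

Lemma knuth_inv_Des_sub u v : knuth u v -> uniq u ->
  inv_Des_sub u v /\ inv_Des_sub v u.
Proof.
elim=> {u v} [u|u v uv IH|v u w uv IHuv vw IHvw|a b x y z xyz|a b x y z xyz] u_uniq.
- by split=> S ? ?; exists S.
- by have [] := IH; rewrite ?(perm_uniq (knuth_perm uv)).
- have [sub_uv sub_vu] := IHuv u_uniq.
  have [|sub_vw sub_wv] := IHvw; first by rewrite -(perm_uniq (knuth_perm uv)).
  have sub_trans p q r : inv_Des_sub p q -> inv_Des_sub q r -> inv_Des_sub p r.
    move=> pq qr S /pq/[apply] -[T [T_sorted T_sub <- <-]].
    exact: qr.
  by split; apply: sub_trans; eassumption.
- have v_uniq : uniq (a ++ [:: z; x; y] ++ b).
    by rewrite -(perm_uniq (knuth_perm (knuth_xzy a b xyz))).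
  have [xy yz] : x < y /\ y < z.
    suff : x != y by lia.
    by move: u_uniq; rewrite !cat_uniq /= !inE => /and3P[_ _ /andP[]]; lia.
  by split; apply: (@inv_Des_sub_block _ _ _ _ x y z);
    rewrite ?xy //=; try (by apply/seq.permP => p /=; lia);
    do ?[case: eqP => ? //=; try lia]; auto.
- have v_uniq : uniq (a ++ [:: y; x; z] ++ b).
    by rewrite -(perm_uniq (knuth_perm (knuth_yzx a b xyz))).
  have [xy yz] : x < y /\ y < z.
    suff : y != z by lia.
    by move: u_uniq; rewrite !cat_uniq /= !inE => /and3P[_ _ /andP[]]; lia.
  by split; apply: (@inv_Des_sub_block _ _ _ _ x y z);
    rewrite ?xy //=; try (by apply/seq.permP => p /=; lia);
    do ?[case: eqP => ? //=; try lia]; auto.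
Qed.

(** * From words back to permutations *)

Lemma index_inverse_word n (pi : 'S_n) (i : 'I_n) :
  index i.+1 (inverse_word pi) = pi i.
Proof.
rewrite -{1}[i](permK pi) (index_map (f := fun v => ((pi^-1)%g v).+1)).
  exact: index_enum_ord.
by move=> v w [/val_inj /perm_inj].
Qed.

Lemma uniq_inverse_word n (pi : 'S_n) : uniq (inverse_word pi).
Proof.
by rewrite map_inj_uniq ?enum_uniq // => v w [/val_inj /perm_inj].
Qed.

Lemma Des_subword n (pi : 'S_n) I :
  Des (subword pi I) = inv_Des (inverse_word pi) [seq i.+1 | i : 'I_n <- enum I].
Proof.
apply: eq_Des; rewrite /subword -map_comp !size_map // => k lt_k.
have [k_I k1_I] : k < size (enum I) /\ k.+1 < size (enum I).
  by split=> //; apply: ltnW.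
case: n => [|n] in pi I lt_k k_I k1_I *; first by case: (enum I) k_I => [|[]].
by rewrite !(nth_map ord0) //= !index_inverse_word.
Qed.

Lemma ls_sub n (pi sigma : 'S_n) D :
  inv_Des_sub (inverse_word pi) (inverse_word sigma) -> ls D pi <= ls D sigma.
Proof.
have mem_inv (tau : 'S_n) (i : 'I_n) : i.+1 \in inverse_word tau.
  by rewrite -[i](permK tau) (map_f (fun v => ((tau^-1)%g v).+1)) ?mem_enum.
have sorted_enum (I : {set 'I_n}) : sorted ltn [seq i.+1 | i : 'I_n <- enum I].
  rewrite (@sorted_pairwise _ ltn ltn_trans) pairwise_map {1}/(enum _).
  apply: pairwise_filter; have := iota_ltn_sorted 0 n.
  by rewrite -val_enum_ord (@sorted_pairwise _ ltn ltn_trans) pairwise_map enumT.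
move=> sub; apply/bigmax_leqP => I /eqP D_I.
have [_ /mapP[i _ ->]|S [S_sorted S_sub S_size S_Des]] :=
  sub [seq i.+1 | i : 'I_n <- enum I] (sorted_enum I); first exact: mem_inv.
pose J := [set i : 'I_n | i.+1 \in S].
have SJ : S = [seq i.+1 | i : 'I_n <- enum J].
  apply: (irr_sorted_eq ltn_trans ltnn) => // k.
  apply/idP/mapP => [kS|[i]]; last by rewrite mem_enum inE => ? ->.
  have /mapP[v _ k_v] := S_sub _ kS.
  by exists ((sigma^-1)%g v); rewrite ?mem_enum ?inE -?k_v.
have -> : #|I| = #|J| by move: S_size; rewrite SJ !size_map -!cardE.
by apply: leq_bigmax_cond; rewrite Des_subword -SJ S_Des -Des_subword D_I.
Qed.

Theorem corollary4p17 (n : nat) (pi sigma : 'S_n) :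
  recording_tableau pi = recording_tableau sigma ->
  forall D : {fset nat}, (D `<=` interval1 n.-1)%fset ->
  ls D pi = ls D sigma.
Proof.
rewrite !recording_tableau_inverse => eq_tableaux D _.
have pi_sigma : knuth (inverse_word pi) (inverse_word sigma).
  apply: knuth_trans (knuth_insertion_tableau _) _; rewrite eq_tableaux.
  exact/knuth_sym/knuth_insertion_tableau.
have [sub_ps sub_sp] := knuth_inv_Des_sub pi_sigma (uniq_inverse_word pi).
by apply/eqP; rewrite eqn_leq !ls_sub.
Qed.
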